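(* Let $n,p$ be positive integers, let $g:\mathbb{R}^n\to\mathbb{R}^p$ be differentiable, let $C(x)=\frac{\partial g^{\mathsf T}}{\partial x}\big|_x\in\mathbb{R}^{n\times p}$, and let $z(t)\in\mathbb{R}^p$ satisfy $z(t+1)=Az(t)$ for integers $t\ge 0$, with $A\in\mathbb{R}^{p\times p}$. Let $N_0=2p-2$, let $N\ge N_0+1$ be an integer, and let $x(0),\dots,x(N)\in\mathbb{R}^n$ be the evaluation points; write $C(t)=C(x(t))$. Assume: (A1) $A$ has distinct and non-zero eigenvalues; (A2) the pair $(A,z(0))$ is controllable; (A3) the pair $(A,C(x_0))$ is observable, where $x_0=x(0)$; (A4) $x(t)=x_0$ for all $0\le t\le N_0$. Let $\overline O(x_0)=\overline U$, the invertible matrix $T\in\mathbb{R}^{p\times p}$ and the transformed parameters $\overline z(t)=Tz(t)$ be as defined in the context, and let $$\overline A=(\overline O_1)^{\dagger}\,\overline O_2,$$ where $\overline O_1$ and $\overline O_2$ consist of the first $n(p-1)$ rows and the last $n(p-1)$ rows of $\overline O(x_0)$, respectively. Let $$M=\begin{bmatrix}\overline z(N_0+1)^{\mathsf T}\otimes C(N_0+1)\\ \vdots\\ \overline z(N)^{\mathsf T}\otimes C(N)\end{bmatrix}\in\mathbb{R}^{n(N-N_0)\times p^2}.$$ Let $\overline A$ be diagonalizable and let $D$ be its diagonal form. Let $\Lambda=D\otimes I_p$ and $F(t)=\mathbf 1_p^{\mathsf T}\otimes C(t)$. Then $M$ has full column rank if and only if the matrix $$W=\begin{bmatrix}F(N_0+1)\\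 F(N_0+2)\Lambda\\ \vdots\\ F(N)\Lambda^{N-N_0-1}\end{bmatrix}$$ has full column rank.
   Context: Setting: the cost $f(x,z(t))=g(x)^{\mathsf T}z(t)$ has gradient $y(x,t)=C(x)z(t)$ with respect to $x$, where $C(x)\in\mathbb{R}^{n\times p}$ has $(i,j)$ entry $\partial g_j/\partial x_i(x)$. The measurements are $y(t)=C(x(t))z(t)$, $t=0,\dots,N$. Controllability of $(A,z(0))$ means that $Z(0)=[z(0)\ Az(0)\ \cdots\ A^{p-1}z(0)]$ is invertible. Observability of $(A,C(x_0))$ means that the observability matrix $O(x_0)$, obtained by stacking $C(x_0),C(x_0)A,\dots,C(x_0)A^{p-1}$, has full column rank $p$. Definition of $\overline O(x_0)$, $T$, $\overline z$: let $Y_{\mathrm h}$ be the block Hankel matrix with $p$ block rows and $p$ columns whose $(i,j)$ block is $y(i+j-2)$, $1\le i,j\le p$; then $Y_{\mathrm h}=O(x_0)Z(0)$ has rank $p$. From a singular value decomposition of $Y_{\mathrm h}$, let $\overline U\in\mathbb{R}^{np\times p}$ be the matrix of left singular vectors corresponding to the non-zero singular values. Since $\overline U$ and $O(x_0)$ have the same column space, there is a unique invertible $T\in\mathbb{R}^{p\times p}$ with $\overline O(x_0):=O(x_0)T^{-1}=\overline U$. Set $\overline z(t)=Tz(t)$ for all $t\ge0$. The superscript $\dagger$ denotes the left (right) pseudo-inverse of a tall (fat) matrix. The diagonal form $D$ of $\overline A$ is a diagonal matrix $D=U^{-1}\overline A U$, where the columns of the invertible matrix $U$ are eigenvectors of $\overline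 A$; $D$ and $U$ may be complex, and then rank is taken over $\mathbb{C}$. $\otimes$ denotes the Kronecker product, $I_p$ the $p\times p$ identity matrix, and $\mathbf 1_p\in\mathbb{R}^p$ the all-ones vector. Thus $F(t)\in\mathbb{R}^{n\times p^2}$ and $\Lambda$ is $p^2\times p^2$.
   Formalization: The case p = 1 is excluded (p ≥ 2 is assumed), since there Ō₁ and Ō₂ have no rows, so Ā is undefined, and reading it as 0 makes the claim false (e.g. n = p = 1, C(x) = x, A = z = 1, x = 1, 0, 1). *)

(* Defs.v *)
From HB Require Import structures.
From mathcomp Require Export all_boot all_order all_algebra.
From mathcomp Require Export complex mxtens.
From mathcomp Require Export all_classical all_reals all_analysis.
Export numFieldNormedType.Exports.
Export Order.TTheory GRing.Theory Num.Theory.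

#[export] Set Implicit Arguments.
#[export] Unset Strict Implicit.
#[export] Unset Printing Implicit Defensive.

Global Open Scope ring_scope.
Global Open Scope complex_scope.

Definition full_col_rank (K : fieldType) (m n : nat) (B : 'M[K]_(m, n)) : Prop :=
  \rank B = n.

Definition cplx_mx (R : rcfType) (m n : nat) (B : 'M[R]_(m, n)) : 'M[R[i]]_(m, n) :=
  map_mx (real_complex R) B.

(* C(x), with (i, j) entry the partial derivative of g_j along x_i; this is the
   transpose of the usual Jacobian matrix. *)
Definition gradmx (R : realType) (n p : nat) (g : 'cV[R]_n -> 'cV[R]_p)
    (x : 'cV[R]_n) : 'M[R]_(n, p) :=
  \matrix_(i < n, j < p) 'D_(delta_mx i 0) (fun u : 'cV[R]_n => g u j 0) x.

(* The eigenvalues of the real matrix A are its complex ones. *)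
Definition distinct_nonzero_eigenvalues (R : rcfType) (p : nat) (A : 'M[R]_p) : Prop :=
  exists s : seq R[i],
    [/\ uniq s, size s = p, 0 \notin s
      & forall l : R[i], (l \in s) = eigenvalue (cplx_mx A) l].

Definition controllable (K : fieldType) (p : nat) (A : 'M[K]_p) (z0 : 'cV[K]_p) : Prop :=
  \matrix_(i < p, j < p) (A ^+ j *m z0) i 0 \in unitmx.

Definition obsmx (K : fieldType) (n p : nat) (A : 'M[K]_p) (C : 'M[K]_(n, p)) :
    'M[K]_(\sum_(i < p) n, p) :=
  \mxcol_(i < p) (C *m A ^+ i).

Definition observable (K : fieldType) (n p : nat) (A : 'M[K]_p) (C : 'M[K]_(n, p)) : Prop :=
  full_col_rank (obsmx A C).

(* Block rows and columns are numbered from 0, so that the (i, j) block is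
   y (i + j). *)
Definition hankelmx (K : fieldType) (n p : nat) (y : nat -> 'cV[K]_n) :
    'M[K]_(\sum_(i < p) n, p) :=
  \mxcol_(i < p) \matrix_(r < n, j < p) y (i + j)%N r 0.

Definition is_svd (R : realType) (m n : nat) (Y : 'M[R]_(m, n))
    (P : 'M[R]_m) (S : 'M[R]_(m, n)) (Q : 'M[R]_n) : Prop :=
  [/\ P^T *m P = 1%:M, Q^T *m Q = 1%:M,
      is_diag_mx S, (forall i j, 0 <= S i j) & Y = P *m S *m Q^T].

(* The columns of U are, without repetition, those columns i of the left
   orthogonal factor P of some SVD of Y for which the i-th singular value exists
   and is non-zero.  No ordering of the singular values is imposed. *)
Definition left_singular_vectors (R : realType) (m n k : nat) (Y : 'M[R]_(m, n))
    (U : 'M[R]_(m, k)) : Prop :=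
  exists (P : 'M[R]_m) (S : 'M[R]_(m, n)) (Q : 'M[R]_n) (f : 'I_k -> 'I_m),
    [/\ is_svd Y P S Q, injective f,
        forall i : 'I_m, (exists c : 'I_k, f c = i) <->
          (exists j : 'I_n, i = j :> nat /\ S i j != 0)
      & U = colsub f P].

(* Left pseudo-inverse of a tall matrix, right pseudo-inverse of a fat one.  The
   value is meaningful only if B has full rank: invmx fixes singular matrices. *)
Definition pseudoinv (K : fieldType) (m n : nat) (B : 'M[K]_(m, n)) : 'M[K]_(n, m) :=
  if (n <= m)%N then invmx (B^T *m B) *m B^T else B^T *m invmx (B *m B^T).

(* Removing the last (resp. first) of p block rows of height n leaves the first
   (resp. last) n(p-1) rows. *)
Definition first_rows (K : fieldType) (n p q : nat) (B : 'M[K]_(\sum_(i < p) n, q)) :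
    'M[K]_(\sum_(i < p.-1) n, q) :=
  \mxcol_(i < p.-1) submxcol B (widen_ord (leq_pred p) i).

(* rev_ord (widen_ord _ (rev_ord i)) is i + 1 in 'I_p. *)
Definition last_rows (K : fieldType) (n p q : nat) (B : 'M[K]_(\sum_(i < p) n, q)) :
    'M[K]_(\sum_(i < p.-1) n, q) :=
  \mxcol_(i < p.-1) submxcol B (rev_ord (widen_ord (leq_pred p) (rev_ord i))).

Definition Abarmx (K : fieldType) (n p : nat) (O : 'M[K]_(\sum_(i < p) n, p)) : 'M[K]_p :=
  pseudoinv (first_rows O) *m last_rows O.

(* V carries the eigenvectors of B as columns. *)
Definition diagonal_form (K : fieldType) (p : nat) (B D : 'M[K]_p) : Prop :=
  exists V : 'M[K]_p, [/\ V \in unitmx, is_diag_mx D & D = invmx V *m B *m V].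

(* Row block k is zb(N0+1+k)^T (x) C(N0+1+k), for 0 <= k < N - N0. *)
Definition Mmx (K : fieldType) (n p N0 N : nat) (zb : nat -> 'cV[K]_p)
    (C : nat -> 'M[K]_(n, p)) : 'M[K]_(\sum_(k < N - N0) (1 * n)%N, p * p) :=
  \mxcol_(k < N - N0) ((zb (N0 + 1 + k)%N)^T *t C (N0 + 1 + k)%N).

Definition Fmx (K : fieldType) (n p : nat) (C : 'M[K]_(n, p)) : 'M[K]_(1 * n, p * p) :=
  (const_mx 1 : 'rV[K]_p) *t C.

Definition Lambdamx (K : fieldType) (p : nat) (D : 'M[K]_p) : 'M[K]_(p * p) :=
  D *t (1%:M : 'M[K]_p).

Definition Wmx (K : fieldType) (n p N0 N : nat) (D : 'M[K]_p)
    (C : nat -> 'M[K]_(n, p)) : 'M[K]_(\sum_(k < N - N0) (1 * n)%N, p * p) :=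
  \mxcol_(k < N - N0) (Fmx (C (N0 + 1 + k)%N) *m Lambdamx D ^+ k).

(* Main.v *)
Require Import Defs.
From mathcomp Require Import zify.

(** Write [A' = T A T^-1] and [C' = C(x_0) T^-1], so that block [i] of [Ubar] is
    [C' A'^i], and let [B] be [Ubar] without its last block; then [Abar] is
    [pseudoinv B *m B *m A'].  If [B] is injective, [Abar = A'], and writing the
    state in an eigenbasis of [A'] gives [M = W (E (x) I)] with [E] invertible, by
    controllability and invertibility of [A].  Observability of [(A, C(x_0))] does
    not make [B] injective; but if [B v = 0] with [v <> 0], the Krylov vectors
    [A'^j v] form a basis on which [C'] vanishes except at the last one, so [C'] has
    rank one.  As [Ubar] has orthonormal columns, [Abar] then acts as a nilpotent
    shift, which contradicts its diagonalizability. *)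

Lemma not_row_free_ex (F : fieldType) (m n : nat) (A : 'M[F]_(m, n)) :
  ~~ row_free A -> exists2 v : 'rV[F]_m, v *m A = 0 & v != 0.
Proof.
rewrite -kermx_eq0 => /rowV0Pn[v vA v0]; exists v => //.
exact/sub_kermxP.
Qed.

Lemma unitmx_ker0 (F : fieldType) (n : nat) (A : 'M[F]_n) :
  (forall w : 'cV[F]_n, A *m w = 0 -> w = 0) -> A \in unitmx.
Proof.
move=> kerA; rewrite -unitmx_tr -row_free_unit.
apply: contraT => /not_row_free_ex[v vA /negP[]].
by rewrite -trmx_eq0; apply/eqP/kerA; rewrite -[A]trmxK -trmx_mul vA trmx0.
Qed.

Lemma tr_mul_self_eq0 (F : realDomainType) (n : nat) (u : 'cV[F]_n) :
  u^T *m u = 0 -> u = 0.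
Proof.
move=> /matrixP/(_ 0 0); rewrite !mxE => /eqP.
rewrite psumr_eq0 => [/allP u0|i _]; last by rewrite mxE -expr2 sqr_ge0.
apply/matrixP => i j; rewrite ord1 mxE.
by have /(_ (mem_index_enum i)) := u0 i; rewrite mxE -expr2 sqrf_eq0 => /eqP.
Qed.

Lemma mul_gram_eq0 (F : realDomainType) (m n : nat) (B : 'M[F]_(m, n))
    (v : 'cV[F]_n) : B^T *m B *m v = 0 -> B *m v = 0.
Proof.
move=> Bv; apply: tr_mul_self_eq0.
by rewrite trmx_mul -mulmxA (mulmxA B^T) Bv mulmx0.
Qed.

Lemma krylov_rank1 (F : fieldType) (n p : nat) (A : 'M[F]_p) (C : 'M[F]_(n, p))
    (v : 'cV[F]_p) :
  (forall i, (i < p.-1)%N -> C *m A ^+ i *m v = 0) ->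
  C *m A ^+ p.-1 *m v != 0 ->
  exists c : 'rV[F]_p, C = C *m A ^+ p.-1 *m v *m c.
Proof.
move=> Cv0 Cv_neq0; set a := _ *m v.
pose K : 'M[F]_p := \matrix_(i, j) (A ^+ j *m v) i 0.
have colK (X : 'M[F]_(n, p)) w :
    X *m (K *m w) = \sum_j w j 0 *: (X *m A ^+ j *m v).
  rewrite (_ : K *m w = \sum_j w j 0 *: (A ^+ j *m v)).
    by rewrite mulmx_sumr; apply: eq_bigr => j _; rewrite -scalemxAr mulmxA.
  apply/matrixP => i k; rewrite ord1 mxE summxE; apply: eq_bigr => j _.
  by rewrite !mxE mulrC.
have Ku : K \in unitmx.
  apply: unitmx_ker0 => w Kw; apply/eqP; apply: contraT => w0.
  have [j0 wj0] : exists j, w j 0 != 0.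
    apply/existsP; apply: contraR w0; rewrite negb_exists => /forallP w0.
    by apply/eqP/matrixP => i k; rewrite ord1 mxE; have /negPn/eqP := w0 i.
  have [j wj jmax] :=
    @arg_maxnP _ j0 (fun j => w j 0 != 0) (fun j => j : nat) wj0.
  have := colK (C *m A ^+ (p.-1 - j)) w; rewrite Kw mulmx0 (bigD1 j) //=.
  have jp : (j <= p.-1)%N by have := ltn_ord j; lia.
  have expD k : C *m A ^+ (p.-1 - j) *m A ^+ k = C *m A ^+ (p.-1 - j + k).
    by rewrite -mulmxA -[A ^+ _ *m _]/(A ^+ _ * A ^+ _) -exprD.
  rewrite expD subnK // big1 ?addr0 => [/esym/eqP|k kj].
    by rewrite scaler_eq0 (negPf wj) (negPf Cv_neq0).
  have [kj'|jk] := ltnP k j; first by rewrite expD Cv0 ?scaler0 //; lia.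
  rewrite (_ : w k 0 = 0) ?scale0r //; apply/eqP; apply: contraNT kj => /jmax kj'.
  by rewrite -val_eqE eqn_leq jk andbT.
pose e : 'rV[F]_p := \row_j (j == p.-1 :> nat)%:R.
exists (e *m invmx K); rewrite mulmxA -[LHS](mulmxK Ku); congr (_ *m _).
apply/matrixP => i j.
have -> : (C *m K) i j = (C *m A ^+ j *m v) i 0.
  by rewrite -mulmxA !mxE; apply: eq_bigr => k _; rewrite mxE.
rewrite [RHS]mxE big_ord1 [e _ _]mxE.
have [->|jp] := eqVneq (j : nat) p.-1; first by rewrite mulr1.
by rewrite Cv0 ?mxE ?mulr0 //; have := ltn_ord j; lia.
Qed.

Lemma diagonal_form_sqr0 (F : fieldType) (p : nat) (B D : 'M[F]_p) (y : 'rV[F]_p) :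
  diagonal_form B D -> y *m B *m B = 0 -> y *m B = 0.
Proof.
case=> V [Vu /is_diag_mxP D_diag DE] yBB.
have BE : B = V *m D *m invmx V.
  by rewrite DE !mulmxA mulmxV // mul1mx mulmxK.
have mulD (w : 'rV[F]_p) j : (w *m D) 0 j = w 0 j * D j j.
  rewrite mxE (bigD1 j) //= big1 ?addr0 // => k kj.
  by rewrite D_diag ?mulr0.
have wDD : y *m V *m D *m D = 0.
  by rewrite -[RHS](mul0mx _ V) -yBB BE !mulmxA !mulmxKV.
rewrite BE !mulmxA (_ : y *m V *m D = 0) ?mul0mx //.
apply/matrixP => i j; have /matrixP/(_ i j) := wDD.
rewrite ord1 !mulD !mxE => /eqP; rewrite mulf_eq0 => /orP[/eqP//|/eqP->].
by rewrite mulr0.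
Qed.

Lemma expmx_conj (F : fieldType) (p k : nat) (A T : 'M[F]_p) :
  T \in unitmx -> (T *m A *m invmx T) ^+ k = T *m A ^+ k *m invmx T.
Proof.
move=> Tu; elim: k => [|k IH]; first by rewrite !expr0 mulmx1 mulmxV.
rewrite !exprSr IH -[LHS]/(_ *m _) -[A ^+ k * A]/(_ *m _) !mulmxA.
by rewrite mulmxKV.
Qed.

Lemma obsmx_conj (F : fieldType) (n p : nat) (A T : 'M[F]_p) (C : 'M[F]_(n, p)) :
  T \in unitmx ->
  obsmx A C *m invmx T = obsmx (T *m A *m invmx T) (C *m invmx T).
Proof.
move=> Tu; rewrite /obsmx mxcol_mul; apply: eq_mxcol => i.
by rewrite expmx_conj // !mulmxA mulmxKV.
Qed.

Lemma first_rows_obsmx (F : fieldType) (n p : nat) (A : 'M[F]_p) (C : 'M[F]_(n, p)) :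
  first_rows (obsmx A C) = \mxcol_(i < p.-1) (C *m A ^+ i).
Proof. by apply: eq_mxcol => i; rewrite mxcolK. Qed.

Lemma last_rows_obsmx (F : fieldType) (n p : nat) (A : 'M[F]_p) (C : 'M[F]_(n, p)) :
  last_rows (obsmx A C) = first_rows (obsmx A C) *m A.
Proof.
rewrite first_rows_obsmx mxcol_mul; apply: eq_mxcol => i; rewrite mxcolK.
rewrite (_ : rev_ord _ = i.+1 :> nat) ?exprSr ?mulmxA //=.
by have := ltn_ord i; lia.
Qed.

Lemma gram_obsmx (F : fieldType) (n p : nat) (A : 'M[F]_p) (C : 'M[F]_(n, p)) :
  (0 < p)%N ->
  (obsmx A C)^T *m obsmx A C =
  (first_rows (obsmx A C))^T *m first_rows (obsmx A C)
  + (C *m A ^+ p.-1)^T *m (C *m A ^+ p.-1).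
Proof.
case: p A C => // p A C _; rewrite first_rows_obsmx /obsmx !tr_mxcol.
by rewrite !mul_mxrow_mxcol big_ord_recr.
Qed.

Lemma left_singular_vectors_orth (R : realType) (m n k : nat)
    (Y : 'M[R]_(m, n)) (U : 'M[R]_(m, k)) :
  left_singular_vectors Y U -> U^T *m U = 1%:M.
Proof.
case=> P [S] [Q] [f] [[PP _ _ _ _] f_inj _ ->].
apply/matrixP => i j; have /matrixP/(_ (f i) (f j)) := PP.
rewrite !mxE (inj_eq f_inj) => <-.
by apply: eq_bigr => l _; rewrite !mxE.
Qed.

(* If the first [p - 1] blocks of [O] are not injective, say on [v], then [C]
   has rank one and [Abarmx O] maps some row [y] to [v^T] and [v^T] to [0],
   also when [pseudoinv] takes a junk value. *)
Lemma Abarmx_jordan (F : realFieldType) (n p : nat) (A : 'M[F]_p)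
    (C : 'M[F]_(n, p)) :
  let O := obsmx A C in
  (1 < p)%N -> O^T *m O = 1%:M ->
  ~~ ((p <= \sum_(i < p.-1) n)%N
      && ((first_rows O)^T *m first_rows O \in unitmx)) ->
  exists2 y : 'rV[F]_p, y *m Abarmx O *m Abarmx O = 0 & y *m Abarmx O != 0.
Proof.
move=> O p1 OO sing; set B := first_rows O in sing *.
have [v Bv v0] : exists2 v : 'cV[F]_p, B *m v = 0 & v != 0.
  move: sing; rewrite negb_and => /orP[fat|].
    have /not_row_free_ex[v vB v0] : ~~ row_free B^T.
      by rewrite /row_free neq_ltn (leq_ltn_trans (rank_leq_col _)) // ltnNge.
    by exists v^T; rewrite ?trmx_eq0 // -[B]trmxK -trmx_mul vB trmx0.
  rewrite -unitmx_tr -row_free_unit => /not_row_free_ex[v vB v0].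
  exists v^T; rewrite ?trmx_eq0 //; apply: mul_gram_eq0.
  by rewrite -[_ *m B]trmxK -trmx_mul vB trmx0.
have Cv i : (i < p.-1)%N -> C *m A ^+ i *m v = 0.
  move=> ip; have := Bv; rewrite /B first_rows_obsmx mxcol_mul.
  by rewrite -(mxcol0 (p_ := fun=> n)) => /eq_mxcolP/(_ (Ordinal ip)).
pose a := C *m A ^+ p.-1 *m v.
have gram : B^T *m B + (C *m A ^+ p.-1)^T *m (C *m A ^+ p.-1) = 1%:M.
  by rewrite -gram_obsmx ?OO // ltnW.
have vE : (C *m A ^+ p.-1)^T *m a = v.
  have := congr1 (mulmx^~ v) gram; rewrite /= mul1mx mulmxDl -(mulmxA _ B) Bv.
  by rewrite mulmx0 add0r -mulmxA.
have a0 : a != 0 by apply: contraNneq v0 => a0; rewrite -vE a0 mulmx0.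
have [c CE] := krylov_rank1 Cv a0; rewrite -/a in CE.
pose y := a^T *m (C *m A ^+ p.-2).
have yA : y *m A = v^T.
  rewrite -[in RHS]vE trmx_mul trmxK /y -!mulmxA -[A ^+ _ *m A]/(_ * _).
  by rewrite -exprSr prednK //; lia.
have yv : y *m v = 0 by rewrite /y -mulmxA Cv ?mulmx0 //; lia.
have yC : y *m (C *m A ^+ p.-1)^T = 0.
  have -> : C *m A ^+ p.-1 = a *m (c *m A ^+ p.-1) by rewrite mulmxA -CE.
  rewrite trmx_mul mulmxA.
  suff -> : y *m (c *m A ^+ p.-1)^T = 0 by rewrite mul0mx.
  have vE' : v = (a^T *m a) 0 0 *: (c *m A ^+ p.-1)^T.
    rewrite -[in LHS]vE {1}CE -mulmxA trmx_mul -mulmxA.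
    by rewrite {1}[a^T *m a]mx11_scalar mul_mx_scalar.
  have aa : (a^T *m a) 0 0 != 0.
    by apply: contraNneq v0 => aa; rewrite vE' aa scale0r.
  move: yv; rewrite vE' -scalemxAr => /eqP; rewrite scaler_eq0 (negPf aa) /=.
  by move/eqP.
have yBB : y *m (B^T *m B) = y.
  have := congr1 (mulmx y) gram; rewrite mulmx1 mulmxDr [X in _ + X]mulmxA.
  by rewrite yC mul0mx addr0.
have [s sB] : exists s, y = s *m B by exists (y *m B^T); rewrite -mulmxA yBB.
have vB : v^T *m B^T = 0 by rewrite -trmx_mul Bv trmx0.
have [yB vB'] : y *m (pseudoinv B *m B) = y /\ v^T *m pseudoinv B = 0.
  rewrite /pseudoinv; case: ifP => tall.
    rewrite tall /= in sing; rewrite /invmx (negPf sing).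
    split; last by rewrite mulmxA (mulmxA v^T) vB !mul0mx.
    by rewrite -(mulmxA (B^T *m B)) (mulmxA y) !yBB.
  split; last by rewrite mulmxA vB mul0mx.
  rewrite !mulmxA; have [BB|BB] := boolP (B *m B^T \in unitmx).
    by rewrite {1}sB -(mulmxA s) mulmxK // -sB.
  by rewrite /invmx (negPf BB) !mulmxA -(mulmxA y) yBB -mulmxA yBB.
have yAbar : y *m Abarmx O = v^T.
  by rewrite /Abarmx last_rows_obsmx -/O -/B -yA -[in RHS]yB !mulmxA.
by exists y; rewrite yAbar ?trmx_eq0 // /Abarmx mulmxA vB' mul0mx.
Qed.

Lemma Abarmx_obs (R : rcfType) (n p : nat) (A : 'M[R]_p) (C : 'M[R]_(n, p))
    (D : 'M[R[i]]_p) :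
  let O := obsmx A C in
  (1 < p)%N -> O^T *m O = 1%:M ->
  diagonal_form (cplx_mx (Abarmx O)) D -> Abarmx O = A.
Proof.
move=> O p1 OO Ddiag.
have [/andP[tall BB]|/(Abarmx_jordan p1 OO)[y yy y0]] :=
    boolP ((p <= \sum_(i < p.-1) n)%N
           && ((first_rows O)^T *m first_rows O \in unitmx)).
  rewrite /Abarmx last_rows_obsmx -/O /pseudoinv tall mulmxA.
  by rewrite -(mulmxA (invmx _)) mulVmx // mul1mx.
move/negP: y0 => []; rewrite -/O -(map_mx_eq0 (real_complex R)).
rewrite map_mxM (diagonal_form_sqr0 Ddiag) //.
by rewrite -!map_mxM yy map_mx0.
Qed.

Lemma unitmx_expr (F : fieldType) (p k : nat) (A : 'M[F]_p) :
  A \in unitmx -> A ^+ k \in unitmx.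
Proof.
move=> Au; elim: k => [|k IH]; first by rewrite expr0 unitmx1.
by rewrite exprS -[_ * _]/(_ *m _) unitmx_mul Au.
Qed.

Lemma unitmx_diag (F : fieldType) (p : nat) (d : 'rV[F]_p) :
  (forall i, d 0 i != 0) -> diag_mx d \in unitmx.
Proof.
by move=> d0; rewrite unitmxE det_diag unitfE; apply/prodf_neq0 => i _.
Qed.

Lemma Lambdamx_expr (F : fieldType) (p k : nat) (D : 'M[F]_p) :
  Lambdamx D ^+ k = Lambdamx (D ^+ k).
Proof.
elim: k => [|k IH].
  rewrite !expr0 /Lambdamx; apply/matrixP => i j.
  case: (mxtens_indexP i) => i1 i2; case: (mxtens_indexP j) => j1 j2.
  rewrite tensmxE !mxE -natrM mulnb; congr (_%:R); congr nat_of_bool.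
  by rewrite (inj_eq (can_inj (@mxtens_indexK p p))) xpair_eqE.
by rewrite !exprS IH -[LHS]/(_ *m _) /Lambdamx tensmx_mul mulmx1.
Qed.

Lemma iter_mulmx (F : fieldType) (p : nat) (A : 'M[F]_p) (z : nat -> 'cV[F]_p) :
  (forall t, z t.+1 = A *m z t) -> forall t, z t = A ^+ t *m z 0%N.
Proof.
move=> zS; elim=> [|t IH]; first by rewrite expr0 mul1mx.
by rewrite zS IH mulmxA exprS.
Qed.

(* In the eigenbasis [V], with [zeta] the coordinates of [zb 0], one has
   [M = W *m ((diag zeta *m D ^+ (N0 + 1) *m V^T) *t 1)], and controllability
   says that no coordinate of [zeta] vanishes. *)
Lemma rank_Mmx (F : fieldType) (n p N0 N : nat) (A D : 'M[F]_p)
    (zb : nat -> 'cV[F]_p) (C : nat -> 'M[F]_(n, p)) :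
  (0 < p)%N -> diagonal_form A D -> A \in unitmx -> controllable A (zb 0%N) ->
  (forall t, zb t.+1 = A *m zb t) ->
  \rank (Mmx N0 N zb C) = \rank (Wmx N0 N D C).
Proof.
move=> p0 [V [Vu /diag_mxP[d dE] DE]] Au ctrl zbS.
pose zeta := (invmx V *m zb 0%N)^T.
have VA : V^T *m A^T = D *m V^T.
  rewrite -[D in RHS]trmxK dE tr_diag_mx -dE -!trmx_mul DE !mulmxA mulmxV //.
  by rewrite mul1mx.
have zbE t : (zb t)^T = zeta *m D ^+ t *m V^T.
  elim: t => [|t IH]; last first.
    by rewrite zbS trmx_mul IH exprSr -(mulmxA _ V^T) VA mulmxA -(mulmxA _ _ D).
  by rewrite expr0 mulmx1 -trmx_mul mulmxA mulmxV // mul1mx.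
have zeta_neq0 i : zeta 0 i != 0.
  apply/eqP => zi; have ziD t : (zeta *m D ^+ t) 0 i = 0.
    elim: t => [|t IH]; first by rewrite expr0 mulmx1.
    by rewrite exprSr mulmxA dE mul_mx_diag mxE -dE IH mul0r.
  have /matrixP/(_ 0 i) : (delta_mx 0 i : 'rV[F]_p) = 0.
    move: ctrl; rewrite /controllable; set Z := \matrix_(_, _) _ => Zu.
    have Vu' : invmx V \in unitmx by rewrite unitmx_inv.
    rewrite -[LHS](mulmxK Vu') -[X in X *m _](mulmxK Zu).
    rewrite (_ : _ *m Z = 0) ?mul0mx //; apply/rowP => j.
    rewrite -mulmxA -rowE [RHS]mxE mxE.
    have <- : (invmx V *m zb j) i 0 = 0.
      rewrite -(ziD j) -[zb j]trmxK zbE trmx_mul trmxK mulmxA mulVmx // mul1mx.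
      by rewrite mxE.
    by rewrite !mxE; apply: eq_bigr => l _; rewrite (iter_mulmx zbS) !mxE.
  by rewrite !mxE !eqxx => /eqP; rewrite oner_eq0.
have Du : D \in unitmx by rewrite DE !unitmx_mul unitmx_inv Vu Au.
pose E := diag_mx zeta *m D ^+ (N0 + 1) *m V^T.
have Eu : E \in unitmx.
  by rewrite !unitmx_mul unitmx_tr Vu unitmx_expr // unitmx_diag.
rewrite (_ : Mmx N0 N zb C = Wmx N0 N D C *m (E *t 1%:M)).
  by rewrite mxrankMfree // row_free_unit tensmx_unit ?unitmx1 -?lt0n.
rewrite /Mmx /Wmx mxcol_mul; apply: eq_mxcol => k.
rewrite Lambdamx_expr /Fmx /Lambdamx !tensmx_mul !mulmx1; congr (_ *t _).
have comm_D : D ^+ k *m diag_mx zeta = diag_mx zeta *m D ^+ k.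
  by apply/esym; apply: commrX; rewrite dE; apply: diag_mxC.
have ones : const_mx 1 *m diag_mx zeta = zeta.
  by apply/rowP => j; rewrite mul_mx_diag !mxE mul1r.
rewrite zbE /E !mulmxA -(mulmxA (const_mx 1)) comm_D mulmxA ones -(mulmxA zeta (D ^+ k)).
by rewrite -[D ^+ k *m _]/(_ * _) -exprD addnC.
Qed.

Lemma controllable_conj (F : fieldType) (p : nat) (A T : 'M[F]_p) (z : 'cV[F]_p) :
  T \in unitmx -> controllable A z -> controllable (T *m A *m invmx T) (T *m z).
Proof.
move=> Tu; rewrite /controllable; set Z := \matrix_(i, j) _ => Zu.
rewrite (_ : \matrix_(i, j) _ = T *m Z) ?unitmx_mul ?Tu //.
apply/matrixP => i j; rewrite mxE expmx_conj // mulmxA mulmxKV // -mulmxA !mxE.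
by apply: eq_bigr => k _; rewrite !mxE.
Qed.

Lemma map_expmx (F F' : fieldType) (f : {rmorphism F -> F'}) (p k : nat)
    (A : 'M[F]_p) : map_mx f (A ^+ k) = map_mx f A ^+ k.
Proof.
elim: k => [|k IH]; first by rewrite !expr0 map_mx1.
by rewrite !exprS -IH -[RHS]map_mxM.
Qed.

Lemma controllable_map (F F' : fieldType) (f : {rmorphism F -> F'}) (p : nat)
    (A : 'M[F]_p) (z : 'cV[F]_p) :
  controllable A z -> controllable (map_mx f A) (map_mx f z).
Proof.
rewrite /controllable -(map_unitmx f); apply: etrans; congr (_ \in unitmx).
by apply/matrixP => i j; rewrite mxE -map_expmx -map_mxM !mxE.
Qed.

Lemma map_Mmx (F F' : fieldType) (f : {rmorphism F -> F'}) (n p N0 N : nat)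
    (zb : nat -> 'cV[F]_p) (C : nat -> 'M[F]_(n, p)) :
  map_mx f (Mmx N0 N zb C) =
  Mmx N0 N (fun t => map_mx f (zb t)) (fun t => map_mx f (C t)).
Proof.
by apply/matrixP => i j; rewrite !mxE rmorphM.
Qed.

Theorem mainTheorem2 (R : realType) (n p : nat) (hn : (0 < n)%N) (hp : (1 < p)%N)
    (g : 'cV[R]_n -> 'cV[R]_p) (hg : forall u : 'cV[R]_n, differentiable g u)
    (A : 'M[R]_p) (z : nat -> 'cV[R]_p) (hz : forall t : nat, z t.+1 = A *m z t)
    (N0 : nat) (hN0 : N0 = (2 * p - 2)%N) (N : nat) (hN : (N0 + 1 <= N)%N)
    (x : nat -> 'cV[R]_n)
    (A1 : distinct_nonzero_eigenvalues A)
    (A2 : controllable A (z 0%N))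
    (A3 : observable A (gradmx g (x 0%N)))
    (A4 : forall t : nat, (t <= N0)%N -> x t = x 0%N)
    (Ubar : 'M[R]_(\sum_(i < p) n, p))
    (hUbar : left_singular_vectors
       (hankelmx p (fun t : nat => gradmx g (x t) *m z t)) Ubar)
    (T : 'M[R]_p) (hT : T \in unitmx)
    (hOT : obsmx A (gradmx g (x 0%N)) *m invmx T = Ubar)
    (D : 'M[R[i]]_p) (hD : diagonal_form (cplx_mx (Abarmx Ubar)) D) :
  full_col_rank
    (Mmx N0 N (fun t : nat => T *m z t) (fun t : nat => gradmx g (x t)))
  <->
  full_col_rank (Wmx N0 N D (fun t : nat => cplx_mx (gradmx g (x t)))).
Proof.
have [s [_ _ s0 sE]] := A1.
have Au : A \in unitmx.
  rewrite -(map_unitmx (real_complex R)) -row_free_unit; apply: contraNT s0.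
  move=> /not_row_free_ex[v vA v0]; rewrite sE; apply/eigenvalueP.
  by exists v; rewrite // scale0r.
have UU := left_singular_vectors_orth hUbar.
move: hD UU; rewrite -hOT obsmx_conj //.
set A' := T *m A *m invmx T => hD UU; have p0 := ltnW hp.
have AE := Abarmx_obs hp UU hD; rewrite AE in hD.
rewrite /full_col_rank -(mxrank_map (real_complex R)) map_Mmx.
rewrite (rank_Mmx _ _ _ p0 hD) //.
- by rewrite map_unitmx !unitmx_mul unitmx_inv hT Au.
- exact/controllable_map/controllable_conj.
- by move=> t; rewrite -map_mxM hz /A' !mulmxA mulmxKV.
Qed.
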